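(* Let $\mathcal{H}$ be a right quaternionic Hilbert space, $I$ a countable set and $\{u_i\}_{i\in I}\subset\mathcal{H}$ a family of vectors. Let $T:\ell^2(\mathbb{H})\to\mathcal{H}$, $T(\{q_i\}_{i\in I})=\sum_{i\in I}u_iq_i$, be its pre-frame operator. Then the following statements are equivalent: (1) $\{u_i\}_{i\in I}$ is a frame for $\mathcal{H}$. (2) $T$ is well defined (i.e. the series $\sum_{i\in I}u_iq_i$ converges in $\mathcal{H}$ for every $\{q_i\}_{i\in I}\in\ell^2(\mathbb{H})$), bounded and surjective.
   Context: $\mathbb{H}$ is the skew field of quaternions, with conjugation $q\mapsto\overline q$ and modulus $|q|$. A right quaternionic Hilbert space is a right $\mathbb{H}$-vector space $\mathcal{H}$ with a map $\langle\cdot\mid\cdot\rangle:\mathcal{H}\times\mathcal{H}\to\mathbb{H}$ (also written $\langle\cdot,\cdot\rangle$) satisfying $\langle u\mid v\rangle=\overline{\langle v\mid u\rangle}$, $\langle v\mid v\rangle>0$ for $v\neq0$, additivity in the second variable and $\langle v\mid uq\rangle=\langle v\mid u\rangle q$ for $q\in\mathbb{H}$, which is complete for the norm $\|u\|=\sqrt{\langle u\mid u\rangle}$. $\ell^2(\mathbb{H})=\{\{q_i\}_{i\in I}\subset\mathbb{H}:\sum_{i\in I}|q_i|^2<\infty\}$ is a right quaternionic Hilbert space with $\langle p\mid q\rangle=\sum_{i\in I}\overline{p_i}q_i$. A family $\{u_i\}_{i\in I}$ in $\mathcal{H}$ is a frame for $\mathcal{H}$ if there exist $0<A\le B<\infty$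 with $A\|u\|^2\le\sum_{i\in I}|\langle u_i,u\rangle|^2\le B\|u\|^2$ for all $u\in\mathcal{H}$. Sums of vectors over $I$ are norm limits of the net of finite partial sums (unconditional convergence). *)

(* Defs.v *)
From HB Require Import structures.
From mathcomp Require Import all_boot all_order all_algebra.
From mathcomp Require Import finmap.
From mathcomp Require Import all_classical all_reals all_analysis.
From mathcomp Require Import ring lra.
(* for totally and partial_sum; not imported because its summable would shadow
   the one of esum.v *)
From mathcomp.analysis.showcase Require summability.

Set Implicit Arguments.
Unset Strict Implicit.
Unset Printing Implicit Defensive.

Import Order.TTheory GRing.Theory Num.Theory.
Import numFieldNormedType.Exports.

Local Open Scope classical_set_scope.
Local Open Scope ring_scope.

(* Quat a b c d is a + b i + c j + d k. *)
Record quat (R : Type) := Quat { qre : R; qi : R; qj : R; qk : R }.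

Section QuatChoice.
Variable T : choiceType.

Definition tuple_of_quat (q : quat T) := (qre q, qi q, qj q, qk q).
Definition quat_of_tuple (t : T * T * T * T) :=
  let: (a, b, c, d) := t in Quat a b c d.

Lemma tuple_of_quatK : cancel tuple_of_quat quat_of_tuple.
Proof. by case. Qed.

HB.instance Definition _ := Choice.copy (quat T) (can_type tuple_of_quatK).
End QuatChoice.

Section QuatRing.
Variable R : realType.
Implicit Types p q r : quat R.

Definition quat_of_real (a : R) : quat R := Quat a 0 0 0.
Definition conjq q := Quat (qre q) (- qi q) (- qj q) (- qk q).
Definition normq q : R :=
  Num.sqrt (qre q ^+ 2 + qi q ^+ 2 + qj q ^+ 2 + qk q ^+ 2).

Definition addq p q :=
  Quat (qre p + qre q) (qi p + qi q) (qj p + qj q) (qk p + qk q).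
Definition oppq q := Quat (- qre q) (- qi q) (- qj q) (- qk q).
Definition mulq p q := Quat
  (qre p * qre q - qi p * qi q - qj p * qj q - qk p * qk q)
  (qre p * qi q + qi p * qre q + qj p * qk q - qk p * qj q)
  (qre p * qj q - qi p * qk q + qj p * qre q + qk p * qi q)
  (qre p * qk q + qi p * qj q - qj p * qi q + qk p * qre q).

Lemma quatP p q :
  qre p = qre q -> qi p = qi q -> qj p = qj q -> qk p = qk q -> p = q.
Proof. by case: p q => [? ? ? ?] [? ? ? ?] /= -> -> -> ->. Qed.

Let addqA : associative addq.
Proof. by move=> p q r; apply: quatP; rewrite /= addrA. Qed.
Let addqC : commutative addq.
Proof. by move=> p q; apply: quatP; rewrite /= addrC. Qed.
Let add0q : left_id (quat_of_real 0) addq.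
Proof. by move=> p; apply: quatP; rewrite /= add0r. Qed.
Let addNq : left_inverse (quat_of_real 0) oppq addq.
Proof. by move=> p; apply: quatP; rewrite /= addNr. Qed.

HB.instance Definition _ :=
  GRing.isZmodule.Build (quat R) addqA addqC add0q addNq.

Let mulqA : associative mulq.
Proof. by move=> p q r; apply: quatP => /=; ring. Qed.
Let mul1q : left_id (quat_of_real 1) mulq.
Proof. by move=> p; apply: quatP => /=; ring. Qed.
Let mulq1 : right_id (quat_of_real 1) mulq.
Proof. by move=> p; apply: quatP => /=; ring. Qed.
Let mulqDl : left_distributive mulq +%R.
Proof. by move=> p q r; apply: quatP => /=; ring. Qed.
Let mulqDr : right_distributive mulq +%R.
Proof. by move=> p q r; apply: quatP => /=; ring. Qed.
Let oneq_neq0 : quat_of_real 1 != 0 :> quat R.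
Proof. by apply/eqP => -[] /eqP; rewrite oner_eq0. Qed.

HB.instance Definition _ := GRing.Zmodule_isNzRing.Build (quat R)
  mulqA mul1q mulq1 mulqDl mulqDr oneq_neq0.

Lemma sqr_normq q :
  normq q ^+ 2 = qre q ^+ 2 + qi q ^+ 2 + qj q ^+ 2 + qk q ^+ 2.
Proof. by rewrite sqr_sqrtr // !addr_ge0 // sqr_ge0. Qed.

Lemma normq_ge0 q : 0 <= normq q.
Proof. exact: sqrtr_ge0. Qed.

Lemma normq_eq0 q : normq q = 0 -> q = 0.
Proof.
move=> q0; have := sqr_normq q; rewrite q0 expr0n /= => /esym/eqP.
rewrite !paddr_eq0 ?addr_ge0 ?sqr_ge0 // !sqrf_eq0.
by case/andP => /andP[/andP[/eqP ? /eqP ?] /eqP ?] /eqP ?; apply: quatP.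
Qed.

Let normqN q : normq (- q) = normq q.
Proof. by rewrite /normq /= !sqrrN. Qed.

Let normqMn q n : normq (q *+ n) = normq q *+ n.
Proof.
have -> : q *+ n = Quat (qre q *+ n) (qi q *+ n) (qj q *+ n) (qk q *+ n).
  elim: n => [|n IHn]; first by rewrite !mulr0n.
  by rewrite mulrS IHn; apply: quatP; rewrite /= mulrS.
apply/eqP; rewrite -(@eqrXn2 _ 2) ?mulrn_wge0 ?normq_ge0 //.
by rewrite sqr_normq /= !exprMn_n -!mulrnDl -sqr_normq.
Qed.

Let ler_normqD p q : normq (p + q) <= normq p + normq q.
Proof.
rewrite -(@ler_pXn2r _ 2) ?nnegrE ?addr_ge0 ?normq_ge0 //.
rewrite sqrrD !sqr_normq /=.
set s := qre p * qre q + qi p * qi q + qj p * qj q + qk p * qk q.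
suff : s <= normq p * normq q by rewrite /s mulr2n => ?; lra.
apply: (le_trans (ler_norm _)).
rewrite -(@ler_pXn2r _ 2) ?nnegrE ?mulr_ge0 ?normq_ge0 //.
rewrite exprMn !sqr_normq real_normK ?num_real // -subr_ge0.
rewrite (_ : _ - _ =
    (qre p * qi q - qi p * qre q) ^+ 2 + (qre p * qj q - qj p * qre q) ^+ 2
  + (qre p * qk q - qk p * qre q) ^+ 2 + (qi p * qj q - qj p * qi q) ^+ 2
  + (qi p * qk q - qk p * qi q) ^+ 2 + (qj p * qk q - qk p * qj q) ^+ 2).
  by rewrite !addr_ge0 // sqr_ge0.
by rewrite /s; ring.
Qed.

HB.instance Definition _ := Num.Zmodule_isNormed.Build R (quat R)
  ler_normqD normq_eq0 normqMn normqN.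

Lemma normqE q : `|q| = normq q.
Proof. by []. Qed.

Lemma mulq_conj q : q * conjq q = quat_of_real (`|q| ^+ 2).
Proof. by rewrite normqE sqr_normq; apply: quatP => /=; ring. Qed.

Lemma conjq_mul q : conjq q * q = quat_of_real (`|q| ^+ 2).
Proof. by rewrite normqE sqr_normq; apply: quatP => /=; ring. Qed.

Definition invq q :=
  if q == 0 then q else quat_of_real (`|q| ^- 2) * conjq q.

Let quat_of_realM : {morph quat_of_real : a b / a * b}.
Proof. by move=> a b; apply: quatP => /=; ring. Qed.

Let quat_of_realC a q : quat_of_real a * q = q * quat_of_real a.
Proof. by apply: quatP => /=; ring. Qed.

Let mulVq : {in [pred q | q != 0], left_inverse 1 invq *%R}.
Proof.
move=> q; rewrite inE => q0; rewrite /invq (negPf q0) -mulrA conjq_mul.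
by rewrite -quat_of_realM mulVf // expf_neq0 // normr_eq0.
Qed.

Let mulqV : {in [pred q | q != 0], right_inverse 1 invq *%R}.
Proof.
move=> q; rewrite inE => q0; rewrite /invq (negPf q0) quat_of_realC mulrA.
by rewrite mulq_conj -quat_of_realM divff // expf_neq0 // normr_eq0.
Qed.

Let unitq p q : q * p = 1 /\ p * q = 1 -> [pred x : quat R | x != 0] p.
Proof.
by case=> qp _ /=; apply: contra_eq_neq qp => ->; rewrite mulr0 eq_sym oner_eq0.
Qed.

Let invq_out : {in [predC [pred q | q != 0]], invq =1 id}.
Proof. by move=> q; rewrite !inE negbK /invq => ->. Qed.

HB.instance Definition _ := GRing.NzRing_hasMulInverse.Build (quat R)
  mulVq mulqV unitq invq_out.

Lemma unitqE q : (q \is a GRing.unit) = (q != 0).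
Proof. by []. Qed.

End QuatRing.

(* The carrier is a complete normed module over the real scalars, which supplies
   the topology; rscale_real and norm_inner say that its real scaling and its
   norm are the ones induced by the right quaternionic structure. *)
HB.mixin Record CompleteNormedModule_isRightQuatHilbert (R : realType) V
    & CompleteNormedModule R V := {
  rscale : V -> quat R -> V;
  rscaleDl : forall u v q, rscale (u + v) q = rscale u q + rscale v q;
  rscaleDr : forall u p q, rscale u (p + q) = rscale u p + rscale u q;
  rscaleA : forall u p q, rscale u (p * q) = rscale (rscale u p) q;
  rscale1 : forall u, rscale u 1 = u;
  rscale_real : forall u (a : R), rscale u (quat_of_real a) = a *: u;
  inner : V -> V -> quat R;
  inner_conj : forall u v, inner u v = conjq (inner v u);
  inner_gt0 : forall v, v != 0 ->
    exists2 a : R, 0 < a & inner v v = quat_of_real a;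
  innerDr : forall v u w, inner v (u + w) = inner v u + inner v w;
  innerZr : forall v u q, inner v (rscale u q) = inner v u * q;
  norm_inner : forall v : V, `|v| = Num.sqrt (qre (inner v v))
}.

#[short(type="rightQuatHilbertType")]
HB.structure Definition RightQuatHilbert (R : realType) :=
  { V of CompleteNormedModule R V
       & CompleteNormedModule_isRightQuatHilbert R V }.

Section Frames.
Variables (R : realType) (H : rightQuatHilbertType R) (I : countType).
Implicit Types (u : I -> H) (q : I -> quat R).

Definition is_frame u := exists A B : R, [/\ 0 < A, A <= B &
  forall v : H,
    ((A * `|v| ^+ 2)%:E
       <= \esum_(i in [set: I]) (`|inner (u i) v| ^+ 2)%:E
       <= (B * `|v| ^+ 2)%:E)%E].

Definition l2 : set (I -> quat R) :=
  [set q | (\esum_(i in [set: I]) (`|q i| ^+ 2)%:E < +oo)%E].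

Definition l2norm q : R :=
  Num.sqrt (fine (\esum_(i in [set: I]) (`|q i| ^+ 2)%:E)).

Definition preframe_psum u q : {fset I} -> H :=
  summability.partial_sum (fun i => rscale (u i) (q i)).

(* Meaningful only where the net of finite partial sums converges: lim is a
   total function with an arbitrary value elsewhere. *)
Definition preframe_op u q : H :=
  lim (preframe_psum u q @ summability.totally).

Definition preframe_well_defined u :=
  forall q, l2 q -> cvg (preframe_psum u q @ summability.totally).

Definition preframe_bounded u :=
  exists C : R, forall q, l2 q -> `|preframe_op u q| <= C * l2norm q.

Definition preframe_surjective u := set_surj l2 [set: H] (preframe_op u).

End Frames.

(* Main.v *)
(* Only the real inner product Re <.|.> is needed.
   (1) => (2): with upper bound B, the inequality
   2 Re(conj(p) q) <= |p|^2/B + B|q|^2 gives |sum_J u_i q_i|^2 <= B sum_J |q_i|^2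
   for finite J, hence convergence and boundedness.  The frame operator
   S v = sum u_i <u_i,v> satisfies A|v|^2 <= Re <v,Sv> and |Sv| <= B|v|, so
   v |-> v - (A/B^2)(Sv - w) is a contraction with constant sqrt(1 - (A/B)^2);
   its fixed point solves Sv = w, so S, a fortiori T, is onto.
   (2) => (1): applying T to the restriction of (<u_i,v>)_i to a finite set gives
   the upper bound.  For the lower bound, the functionals Re <v|.> with
   sum |<u_i,v>|^2 <= 1 are bounded pointwise at every w = T q, hence uniformly
   by Banach-Steinhaus, which bounds |v|. *)

Require Import Defs.
From HB Require Import structures.
From mathcomp Require Import all_boot all_order all_algebra.
From mathcomp Require Import finmap.
From mathcomp Require Import all_classical all_reals all_analysis.
From mathcomp Require Import ring lra.
From mathcomp.analysis.showcase Require summability.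

Set Implicit Arguments.
Unset Strict Implicit.
Unset Printing Implicit Defensive.

Import Order.TTheory GRing.Theory Num.Theory.
Import numFieldNormedType.Exports.

Local Open Scope classical_set_scope.
Local Open Scope ring_scope.

#[local] Existing Instance summability.totally_filter.

(** Every bound on an extended-real sum passes through this, so that estimates are made on finite
    real sums only. *)
Lemma esum_EFin_leP (R : realType) (T : choiceType) (a : T -> R) (M : R) :
  (\esum_(i in [set: T]) (a i)%:E <= M%:E)%E <->
  forall J : {fset T}, \sum_(i <- J) a i <= M.
Proof.
split=> [leM J|leM].
  rewrite -lee_fin -sumEFin; apply: le_trans leM; apply: ereal_sup_ubound.
  by exists [set` J]; rewrite ?fsbig_finite ?set_fsetK//; split.
apply: ge_ereal_sup => _ [X [finX _] <-].
by rewrite fsbig_finite//= sumEFin lee_fin.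
Qed.

(** * Real dot product of quaternions *)

Section QuaternionDotProduct.
Variable R : realType.
Implicit Types p q : quat R.

Definition dotq p q : R := qre (conjq p * q).

Lemma dotqE p q :
  dotq p q = qre p * qre q + qi p * qi q + qj p * qj q + qk p * qk q.
Proof. by rewrite /dotq /=; ring. Qed.

Lemma sqr_quat_norm q :
  `|q| ^+ 2 = qre q ^+ 2 + qi q ^+ 2 + qj q ^+ 2 + qk q ^+ 2.
Proof. exact: sqr_normq. Qed.

Lemma dotqq q : dotq q q = `|q| ^+ 2.
Proof. by rewrite /dotq conjq_mul. Qed.

(** Right side minus left side is [t^-1] times the squared norm of p - tq. *)
Lemma dotq_le_wt (t : R) p q : 0 < t ->
  dotq p q *+ 2 <= t^-1 * `|p| ^+ 2 + t * `|q| ^+ 2.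
Proof.
move=> t0; rewrite -subr_ge0 dotqE !sqr_quat_norm.
rewrite (_ : _ - _ = t^-1 * ((qre p - t * qre q) ^+ 2 + (qi p - t * qi q) ^+ 2
    + (qj p - t * qj q) ^+ 2 + (qk p - t * qk q) ^+ 2)).
  by rewrite mulr_ge0 ?invr_ge0 ?(ltW t0)// !addr_ge0// sqr_ge0.
by field; rewrite gt_eqF.
Qed.

Lemma dotqNl p q : dotq (- p) q = - dotq p q.
Proof. by rewrite !dotqE /=; ring. Qed.

Lemma normr_dotq_le p q : `|dotq p q| *+ 2 <= `|p| ^+ 2 + `|q| ^+ 2.
Proof.
have le1 p' : dotq p' q *+ 2 <= `|p'| ^+ 2 + `|q| ^+ 2.
  by have := dotq_le_wt p' q ltr01; rewrite invr1 !mul1r.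
rewrite -normrMn ler_norml le1 lerNl andbT -mulNrn -dotqNl.
by rewrite (le_trans (le1 _))// normrN.
Qed.

End QuaternionDotProduct.

(** * Real part of the inner product *)

Section RealInnerProduct.
Variables (R : realType) (H : rightQuatHilbertType R).
Implicit Types u v w : H.

Definition re_inner v w : R := qre (inner v w).

Lemma re_innerC v w : re_inner v w = re_inner w v.
Proof. by rewrite /re_inner inner_conj. Qed.

Lemma re_inner_linear v : linear (re_inner v : H -> R^o).
Proof.
move=> a w w'; rewrite /re_inner innerDr -rscale_real innerZr /=.
by rewrite !mulr0 !subr0 mulrC.
Qed.

HB.instance Definition _ v :=
  GRing.isLinear.Build R H R^o *:%R (re_inner v) (re_inner_linear v).

Lemma re_innerDr v w w' : re_inner v (w + w') = re_inner v w + re_inner v w'.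
Proof. exact: raddfD. Qed.

Lemma re_innerZr v (a : R) w : re_inner v (a *: w) = a * re_inner v w.
Proof. exact: linearZ. Qed.

Lemma re_innervv v : re_inner v v = `|v| ^+ 2.
Proof.
rewrite norm_inner sqr_sqrtr -/(re_inner v v)//; have [->|v0] := eqVneq v 0.
  by have -> : re_inner 0 0 = 0 := raddf0 (re_inner 0 : {linear H -> R^o}).
by rewrite /re_inner; have [a a0 ->] := inner_gt0 v v0; exact: ltW.
Qed.

Lemma sqr_normD v w : `|v + w| ^+ 2 = `|v| ^+ 2 + re_inner v w *+ 2 + `|w| ^+ 2.
Proof.
rewrite -!re_innervv re_innerDr re_innerC re_innerDr.
by rewrite (re_innerC (v + w) w) re_innerDr (re_innerC w v); ring.
Qed.

(** Cauchy-Schwarz falls out of the triangle inequality, already part of the normed structure, once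
    it is squared. *)
Lemma re_inner_le v w : re_inner v w <= `|v| * `|w|.
Proof.
have := ler_normD v w; rewrite -(@ler_pXn2r _ 2) ?nnegrE ?addr_ge0//.
rewrite sqr_normD sqrrD; nra.
Qed.

Lemma normr_re_inner_le v w : `|re_inner v w| <= `|v| * `|w|.
Proof.
rewrite ler_norml re_inner_le lerNl andbT -mulN1r -re_innerZr scaleN1r.
by rewrite (le_trans (re_inner_le _ _))// normrN.
Qed.

Lemma re_inner_bounded v : bounded_fun_norm (re_inner v : H -> R^o).
Proof.
move=> r; exists (`|v| * r) => w wr.
by rewrite (le_trans (normr_re_inner_le _ _))// ler_wpM2l.
Qed.

Lemma re_inner_continuous v : continuous (re_inner v : H -> R^o).
Proof.
apply: (@linear_continuous _ _ _ (re_inner v : {linear H -> R^o})).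
exact/bounded_landau/re_inner_bounded.
Qed.

Lemma re_inner_rscale v u q : re_inner v (rscale u q) = dotq (inner u v) q.
Proof. by rewrite /re_inner innerZr inner_conj. Qed.

End RealInnerProduct.

Lemma big_fset_split (I : choiceType) (V : Type) (idx : V)
    (op : Monoid.com_law idx) (F : I -> V) (J K : {fset I}) : (J `<=` K)%fset ->
  \big[op/idx]_(i <- K) F i = op (\big[op/idx]_(i <- J) F i)
    (\big[op/idx]_(i <- [fset i in K | i \notin J]%fset) F i).
Proof.
move=> JK; rewrite (big_fsetID _ (mem J)); congr (op _ _).
congr (bigop.body _ _ _); congr enum_fset; apply/fsetP => i; rewrite !inE /=.
by apply/andP/idP => [[]//|iJ]; split=> //; exact: (fsubsetP JK).
Qed.

Section SquareSummable.
Variables (R : realType) (I : countType) (q : I -> quat R).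
Hypothesis l2q : l2 q.

Lemma l2_esumE :
  (\esum_(i in [set: I]) (`|q i| ^+ 2)%:E = (l2norm q ^+ 2)%:E)%E.
Proof.
have ge0 : (0 <= \esum_(i in [set: I]) (`|q i| ^+ 2)%:E)%E.
  by apply: esum_ge0 => i _; rewrite lee_fin sqr_ge0.
by rewrite /l2norm sqr_sqrtr ?fine_ge0// fineK// ge0_fin_numE.
Qed.

Lemma l2_sum_le (J : {fset I}) : \sum_(i <- J) `|q i| ^+ 2 <= l2norm q ^+ 2.
Proof. by move: J; apply/esum_EFin_leP; rewrite l2_esumE. Qed.

End SquareSummable.

(** * Partial sums of the pre-frame series *)

Section PreframeOperator.
Variables (R : realType) (H : rightQuatHilbertType R) (I : countType).
Variable u : I -> H.
Implicit Types (q : I -> quat R) (v w : H) (J : {fset I}).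

Definition analysis_op v : I -> quat R := fun i => inner (u i) v.

Lemma preframe_psumE q J :
  preframe_psum u q J = \sum_(i <- J) rscale (u i) (q i).
Proof. by rewrite big_seq_fsetE. Qed.

Lemma re_inner_psum v q J :
  re_inner v (preframe_psum u q J) = \sum_(i <- J) dotq (analysis_op v i) (q i).
Proof.
rewrite preframe_psumE (raddf_sum (re_inner v : {linear H -> R^o}))/=.
by apply: eq_bigr => i _; rewrite re_inner_rscale.
Qed.

Lemma re_inner_psum_analysis v J :
  re_inner v (preframe_psum u (analysis_op v) J)
  = \sum_(i <- J) `|analysis_op v i| ^+ 2.
Proof. by rewrite re_inner_psum; apply: eq_bigr => i _; rewrite dotqq. Qed.

(** The net of partial sums is constant beyond [J]. *)
Lemma preframe_op_restrict q J : (forall i, i \notin J -> q i = 0) ->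
  preframe_op u q = preframe_psum u q J.
Proof.
move=> q0; apply: (cvg_lim (@norm_hausdorff _ _)).
apply: cvg_near_cst; exists J => //= K JK.
rewrite !preframe_psumE -(big_fset_incl _ JK)// => i _ /q0 ->.
by rewrite -[0]/(quat_of_real 0) rscale_real scale0r.
Qed.

Lemma re_inner_psum_cvg v q : cvg (preframe_psum u q @ summability.totally) ->
  re_inner v (preframe_psum u q J) @[J --> summability.totally]
    --> re_inner v (preframe_op u q).
Proof.
move=> cq; apply: (@continuous_cvg _ _ _ _ _ _ (re_inner v) _ _ cq).
exact: re_inner_continuous.
Qed.

Definition bessel_bound (B : R) := forall v J,
  \sum_(i <- J) `|analysis_op v i| ^+ 2 <= B * `|v| ^+ 2.

(** * Bessel families and surjectivity of the frame operator *)

Section Bessel.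
Variable B : R.
Hypotheses (B0 : 0 < B) (besselB : bessel_bound B).

(** Pair the partial sum [s] with itself and apply [dotq_le_wt] with weight [B]: the Bessel bound
    makes the first term at most the squared norm of [s], which cancels one of the two copies on the
    left. *)
Lemma bessel_psum_le q J :
  `|preframe_psum u q J| ^+ 2 <= B * \sum_(i <- J) `|q i| ^+ 2.
Proof.
set s := preframe_psum u q J.
have : re_inner s s *+ 2 <= B^-1 * \sum_(i <- J) `|analysis_op s i| ^+ 2 +
    B * \sum_(i <- J) `|q i| ^+ 2.
  rewrite {2}/s re_inner_psum -sumrMnl !mulr_sumr -big_split/=.
  by apply: ler_sum => i _; exact: dotq_le_wt.
have : B^-1 * \sum_(i <- J) `|analysis_op s i| ^+ 2 <= `|s| ^+ 2.
  by rewrite ler_pdivrMl.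
rewrite re_innervv mulr2n; lra.
Qed.

Lemma bessel_cvg q : l2 q -> cvg (preframe_psum u q @ summability.totally).
Proof.
move=> l2q; apply/cauchy_cvgP/cauchy_exP => e e0.
set M := l2norm q ^+ 2.
(* [J] captures the sum of squares up to [B^-1 * e ^+ 2], so by [bessel_psum_le] any finite sum of
   terms outside [J] has norm below [e]. *)
have [J MJ] : exists J : {fset I},
    M - B^-1 * e ^+ 2 < \sum_(i <- J) `|q i| ^+ 2.
  apply: contrapT => /forallNP MJ.
  have : (\esum_(i in [set: I]) (`|q i| ^+ 2)%:E <= (M - B^-1 * e ^+ 2)%:E)%E.
    by apply/esum_EFin_leP => J; rewrite leNgt; apply/negP/MJ.
  rewrite (l2_esumE l2q) lee_fin leNgt ltrBlDr ltrDl.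
  by rewrite mulr_gt0 ?invr_gt0 ?exprn_gt0.
exists (preframe_psum u q J); exists J => //= K JK.
set K' := [fset i in K | i \notin J]%fset.
have MK := l2_sum_le l2q K.
rewrite -ball_normE /= distrC.
rewrite !preframe_psumE (big_fset_split _ _ JK) addrAC subrr add0r.
rewrite -preframe_psumE.
rewrite -(@ltr_pXn2r _ 2) ?nnegrE ?(ltW e0)//.
apply: le_lt_trans (bessel_psum_le _ _) _.
rewrite -ltr_pdivlMl//; move: MK.
rewrite -/M (big_fset_split _ _ JK) -/K' /=; lra.
Qed.

(** A free [M] serves both uses: the squared [l2norm] for the boundedness of T, and the Bessel bound
    of [v] for [frame_op_le]. *)
Lemma bessel_op_le q M : l2 q ->
  (forall J, \sum_(i <- J) `|q i| ^+ 2 <= M) ->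
  `|preframe_op u q| ^+ 2 <= B * M.
Proof.
move=> l2q qM; have M0 : 0 <= M.
  by have := qM fset0; rewrite big_seq_fset0.
have BM0 : 0 <= B * M by rewrite mulr_ge0// ltW.
rewrite -(sqr_sqrtr BM0) ler_pXn2r ?nnegrE ?sqrtr_ge0//.
apply: (cvgr_to_le (cvg_norm (bessel_cvg l2q))).
near=> J; rewrite -(@ler_pXn2r _ 2) ?nnegrE ?sqrtr_ge0// sqr_sqrtr//.
by rewrite (le_trans (bessel_psum_le _ _))// ler_pM2l.
Unshelve. all: by end_near. Qed.

Lemma bessel_l2 v : l2 (analysis_op v).
Proof.
rewrite /l2/=; apply: (@le_lt_trans _ _ (B * `|v| ^+ 2)%:E); last exact: ltry.
by apply/esum_EFin_leP => J; exact: besselB.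
Qed.

Definition frame_op v : H := preframe_op u (analysis_op v).

Lemma frame_opB v w : frame_op (v - w) = frame_op v - frame_op w.
Proof.
apply: (cvg_lim (@norm_hausdorff _ _)).
rewrite (_ : preframe_psum u (analysis_op (v - w)) =
    preframe_psum u (analysis_op v) \- preframe_psum u (analysis_op w)).
  exact: cvgB (bessel_cvg (bessel_l2 v)) (bessel_cvg (bessel_l2 w)).
apply/funext => J; rewrite /= !preframe_psumE -sumrB; apply: eq_bigr => i _.
by apply/eqP; rewrite -subr_eq opprK -rscaleDr /analysis_op -innerDr subrK.
Qed.

Lemma frame_op_le v : `|frame_op v| <= B * `|v|.
Proof.
rewrite -(@ler_pXn2r _ 2) ?nnegrE ?mulr_ge0// ?(ltW B0)//.
have := @bessel_op_le (analysis_op v) _ (bessel_l2 v) (@besselB v).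
by rewrite exprMn expr2 mulrA.
Qed.

(** The pairings of [v] with the partial sums are sums of squares, hence increase with [J] to their
    limit. *)
Lemma sum_le_re_inner_frame_op v J :
  \sum_(i <- J) `|analysis_op v i| ^+ 2 <= re_inner v (frame_op v).
Proof.
apply: (cvgr_to_ge (re_inner_psum_cvg (v := v) (bessel_cvg (bessel_l2 v)))).
exists J => //= K JK; rewrite re_inner_psum_analysis.
by rewrite [leRHS](big_fset_split _ _ JK) lerDl sumr_ge0.
Qed.

Variable A : R.
Hypotheses (A0 : 0 < A) (AB : A <= B).
Hypothesis frameA : forall v,
  ((A * `|v| ^+ 2)%:E <= \esum_(i in [set: I]) (`|inner (u i) v| ^+ 2)%:E)%E.

Lemma frame_op_ge v : A * `|v| ^+ 2 <= re_inner v (frame_op v).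
Proof.
rewrite -lee_fin; apply: le_trans (frameA v) _.
by apply/esum_EFin_leP => J; exact: sum_le_re_inner_frame_op.
Qed.

Lemma frame_op_surj w : exists v, frame_op v = w.
Proof.
(* This [t] minimises 1 - 2tA + t^2 B^2, the bound on the squared Lipschitz constant of [f]; the
   minimum is 1 - (A/B)^2. *)
pose t := A / B ^+ 2.
have t0 : 0 < t by rewrite divr_gt0// exprn_gt0.
pose f v := v - t *: (frame_op v - w).
pose k := Num.sqrt (1 - (A / B) ^+ 2).
have c0 : 0 < A / B by rewrite divr_gt0.
have c1 : A / B <= 1 by rewrite ler_pdivrMr// mul1r.
have k1 : k < 1.
  by rewrite -sqrtr1 ltr_sqrt// ltrBlDr ltrDl exprn_gt0.
have k2 : k ^+ 2 = 1 - (A / B) ^+ 2.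
  by rewrite sqr_sqrtr// subr_ge0 exprn_ile1// ltW.
have lip v v' : `|f v - f v'| <= k * `|v - v'|.
  rewrite (_ : f v - f v' = v - v' - t *: frame_op (v - v')); last first.
    by rewrite frame_opB /f opprD addrACA -opprD -scalerBr opprB addrA subrK.
  set d := v - v'.
  rewrite -(@ler_pXn2r _ 2) ?nnegrE ?mulr_ge0 ?sqrtr_ge0//.
  rewrite sqr_normD normrN normrZ -scaleNr re_innerZr !exprMn k2.
  rewrite real_normK ?num_real//.
  (* The cross term, counted twice, gains at least what [SA] gives each time; the quadratic term
     loses at most one such amount by [SB]. *)
  have SA : (A / B) ^+ 2 * `|d| ^+ 2 <= t * re_inner d (frame_op d).
    rewrite (_ : (A / B) ^+ 2 = t * A); last first.
      by rewrite /t; field; rewrite gt_eqF.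
    by rewrite -mulrA ler_pM2l//; exact: frame_op_ge.
  have SB : t ^+ 2 * `|frame_op d| ^+ 2 <= (A / B) ^+ 2 * `|d| ^+ 2.
    have -> : (A / B) ^+ 2 = t ^+ 2 * B ^+ 2.
      by rewrite /t; field; rewrite gt_eqF.
    rewrite -mulrA -(exprMn _ B) ler_pM2l ?exprn_gt0//.
    rewrite ler_pXn2r ?nnegrE ?mulr_ge0//.
      exact: frame_op_le.
    exact: ltW.
  by rewrite mulNr mulrBl mul1r; lra.
have k0 : 0 <= k by exact: sqrtr_ge0.
have ctr : is_contraction (totalfun f : {fun [set: H] >-> [set: H]}).
  by exists (NngNum k0); split=> // -[v v'] _; exact: lip.
have [|v _] := banach_fixed_point ctr closedT; first by exists 0.
rewrite /totalfun_ /f => /eqP; rewrite -subr_eq0 opprB addrCA subrr addr0.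
by rewrite scaler_eq0 gt_eqF//= subr_eq0 => /eqP; exists v.
Qed.

End Bessel.
End PreframeOperator.

(** * Frame bounds from boundedness and surjectivity *)

Section SurjectivePreframe.
Variables (R : realType) (H : rightQuatHilbertType R) (I : countType).
Variable u : I -> H.

Lemma preframe_bounded_bessel :
  preframe_bounded u -> exists B, bessel_bound u B.
Proof.
case=> C opC; exists (`|C| ^+ 2) => v J; set X := \sum_(i <- J) _.
have X0 : 0 <= X by apply: sumr_ge0 => i _; exact: sqr_ge0.
(* Truncation to [J] makes T q a finite sum whose pairing with [v] is [X], while [l2norm q] is at
   most the root of [X]. Cauchy-Schwarz then leaves one root of [X] to divide out. *)
pose q i := if i \in J then analysis_op u v i else 0.
have qJ i : i \notin J -> q i = 0 by rewrite /q => /negPf ->.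
have qX (K : {fset I}) : \sum_(i <- K) `|q i| ^+ 2 <= X.
  have -> : X = \sum_(i <- (K `|` J)%fset) `|q i| ^+ 2.
    rewrite -(big_fset_incl _ (fsubsetUr K J)); last first.
      by move=> i _ /qJ ->; rewrite normr0 expr0n.
    by apply: eq_big_seq => i iJ; rewrite /q iJ.
  rewrite [leRHS](big_fset_split _ _ (fsubsetUl K J)) lerDl.
  by apply: sumr_ge0 => i _; exact: sqr_ge0.
have qle : (\esum_(i in [set: I]) (`|q i| ^+ 2)%:E <= X%:E)%E.
  exact/esum_EFin_leP.
have l2q : l2 q by exact: le_lt_trans qle (ltry _).
have q_norm : l2norm q <= Num.sqrt X.
  by rewrite -(@ler_pXn2r _ 2) ?nnegrE ?sqrtr_ge0// (sqr_sqrtr X0)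
    -lee_fin -l2_esumE.
have le1 : `|preframe_op u q| <= `|C| * Num.sqrt X.
  apply: le_trans (opC q l2q) _.
  by rewrite (le_trans (ler_norm _))// normrM ler_wpM2l// ger0_norm// sqrtr_ge0.
have : X <= `|v| * (`|C| * Num.sqrt X).
  rewrite {1}/X -re_inner_psum_analysis.
  have -> : preframe_psum u (analysis_op u v) J = preframe_op u q.
    rewrite (preframe_op_restrict _ qJ) !preframe_psumE.
    by apply: eq_big_seq => i iJ; rewrite /q iJ.
  by rewrite (le_trans (re_inner_le _ _))// ler_wpM2l.
have [X00|Xn0] := eqVneq X 0.
  by move=> _; rewrite X00 mulr_ge0// sqr_ge0.
have sX0 : 0 < Num.sqrt X by rewrite sqrtr_gt0 lt_def Xn0.
move=> le2; have le3 : Num.sqrt X <= `|v| * `|C|.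
  by rewrite -(ler_pM2r sX0) -mulrA -expr2 sqr_sqrtr.
rewrite -(sqr_sqrtr X0) -exprMn mulrC.
by rewrite ler_pXn2r ?nnegrE ?mulr_ge0 ?sqrtr_ge0.
Qed.

Lemma sqr_norm_analysis_opZ (a : R) v i :
  `|analysis_op u (a *: v) i| ^+ 2 = a ^+ 2 * `|analysis_op u v i| ^+ 2.
Proof.
by rewrite /analysis_op -rscale_real innerZr !sqr_quat_norm /=; ring.
Qed.

Lemma preframe_surjective_ball :
  preframe_well_defined u -> preframe_surjective u ->
  exists2 K : R, 0 < K & forall v,
    (forall J : {fset I}, \sum_(i <- J) `|analysis_op u v i| ^+ 2 <= 1) ->
    `|v| < K.
Proof.
move=> wd surj.
pose F : set (H -> R^o) := [set f | exists2 v,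
  f = re_inner v :> (H -> R^o) &
  forall J : {fset I}, \sum_(i <- J) `|analysis_op u v i| ^+ 2 <= 1].
have Flin f : F f -> bounded_fun_norm f /\ linear f.
  by case=> v -> _; split; [exact: re_inner_bounded | exact: re_inner_linear].
have Fpt : pointwise_bounded F.
  move=> w; have [q l2q <-] := surj w Logic.I.
  (* The 1 bounds the coefficients of [v], the other term those of [q], through [normr_dotq_le] on
     each summand. *)
  exists (1 + l2norm q ^+ 2) => _ [v -> v1].
  apply: (cvgr_to_le (cvg_norm (re_inner_psum_cvg (v := v) (wd _ l2q)))).
  apply: nearW => J; rewrite re_inner_psum (le_trans (ler_norm_sum _ _ _))//.
  apply: le_trans (lerD (v1 J) (l2_sum_le l2q J)); rewrite -big_split/=.
  apply: ler_sum => i _; apply: le_trans (normr_dotq_le _ _).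
  by rewrite mulr2n lerDl.
have [M FM] := Banach_Steinhauss Flin Fpt 1.
(* Adding 1 makes the radius positive and the bound strict; [preframe_surjective_lower] relies on
   the strictness. *)
exists (`|M| + 1); first by rewrite ltr_wpDl.
move=> v v1; rewrite (@le_lt_trans _ _ `|M|) ?ltrDl//.
have [->|v0] := eqVneq v 0; first by rewrite normr0.
have nv0 : 0 < `|v| by rewrite normr_gt0.
(* At the unit vector along [v], the functional of [v] takes the value of its norm. *)
have := FM _ (ex_intro2 _ _ v erefl v1) (`|v|^-1 *: v).
rewrite normrZ normfV normr_id mulVf ?gt_eqF// => /(_ (lexx _)).
rewrite re_innerZr re_innervv expr2 mulKf ?gt_eqF// normr_id.
move/le_trans; apply; exact: ler_norm.
Qed.

Lemma preframe_surjective_lower :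
  preframe_well_defined u -> preframe_surjective u ->
  exists2 A : R, 0 < A & forall v,
    ((A * `|v| ^+ 2)%:E <= \esum_(i in [set: I]) (`|inner (u i) v| ^+ 2)%:E)%E.
Proof.
move=> wd surj; have [K K0 Kv] := preframe_surjective_ball wd surj.
exists (K ^- 2); first by rewrite invr_gt0 exprn_gt0.
move=> v; rewrite leNgt; apply/negP => vlt.
have [v0|v0] := eqVneq v 0.
  by move: vlt; rewrite v0 normr0 expr0n mulr0 ltNge esum_ge0.
have nv0 : 0 < `|v| by rewrite normr_gt0.
(* The rescaled vector has norm exactly [K], yet if the lower bound fails at [v], its coefficients
   have square sum at most (K/|v|)^2 K^-2 |v|^2 = 1. *)
have : `|(K / `|v|) *: v| < K.
  apply: Kv => J.
  have /esum_EFin_leP/(_ J) := ltW vlt => leJ.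
  under eq_bigr do rewrite sqr_norm_analysis_opZ.
  rewrite -mulr_sumr; apply: le_trans (ler_wpM2l (sqr_ge0 _) leJ) _.
  by rewrite le_eqVlt; apply/orP; left; apply/eqP; field; rewrite !gt_eqF.
by rewrite normrZ normrM normfV normr_id divfK ?gt_eqF// gtr0_norm// ltxx.
Qed.

End SurjectivePreframe.

Theorem theorem13 (R : realType) (H : rightQuatHilbertType R) (I : countType)
    (u : I -> H) :
  is_frame u <->
  [/\ preframe_well_defined u, preframe_bounded u & preframe_surjective u].
Proof.
split=> [[A [B [A0 AB frameAB]]]|[wd bnd surj]].
  have B0 : 0 < B := lt_le_trans A0 AB.
  have besselB : bessel_bound u B.
    by move=> v; apply/esum_EFin_leP; have /andP[] := frameAB v.
  have frameA v := (andP (frameAB v)).1.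
  split=> [q l2q| |w _].
  - exact: bessel_cvg B0 besselB _ l2q.
  - exists (Num.sqrt B) => q l2q.
    rewrite -(@ler_pXn2r _ 2) ?nnegrE ?mulr_ge0 ?sqrtr_ge0// exprMn.
    by rewrite sqr_sqrtr ?(ltW B0)// (bessel_op_le B0)//; exact: l2_sum_le.
  - have [v <-] := frame_op_surj B0 besselB A0 AB frameA w.
    by exists (analysis_op u v) => //; exact: bessel_l2 besselB v.
have [A A0 frameA] := preframe_surjective_lower wd surj.
have [B besselB] := preframe_bounded_bessel bnd.
(* The two constants come from unrelated arguments, so the maximum secures the order required of
   frame bounds. *)
exists A, (Num.max A B); split; rewrite ?le_max ?lexx// => v.
rewrite frameA/=; apply/esum_EFin_leP => J; apply: le_trans (besselB v J) _.
by rewrite ler_wpM2r ?sqr_ge0// le_max lexx orbT.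
Qed.
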